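(* If $\Gamma\vdash M_1$ is derivable and $M_1\rightarrow M_2$, then $\Gamma\vdash M_2$ is derivable. If $\Gamma\vdash s_1\triangleright\Delta$ is derivable and $s_1\rightarrow s_2$, then $\Gamma\vdash s_2\triangleright\Delta$ is derivable.
   Context: Calculus $\lambda\pi$. Terms and substitutions: $M,N::= a\mid MN\mid\lambda a.M\mid s\circ M$ and $s,q::= id\mid\pi_a\mid\langle s\,,\,N\backslash a\rangle\mid s\circ q$, where $a,b$ range over variables; $\langle s\,,\,N\backslash a\rangle$ is the substitution $s$ extended by ''$N$ for $a$'', $s\circ M$ is $M$ under the explicit substitution $s$, $\pi_a$ is a shift. Conventions: $s\circ q\circ M$ means $s\circ(q\circ M)$, $s\circ q\circ r$ means $s\circ(q\circ r)$, $s\circ MN$ means $s\circ(MN)$. Contexts are finite lists of variables with repetitions allowed. Derivable judgements $\Gamma\vdash M$ and $\Gamma\vdash s\triangleright\Delta$ are generated by: (i) $\Gamma,a\vdash a$; (ii) from $\Gamma\vdash a$ infer $\Gamma,b\vdash a$ ($a\neq b$); (iii) from $\Gamma\vdash M$, $\Gamma\vdash N$ infer $\Gamma\vdash MN$; (iv) from $\Gamma,a\vdash M$ infer $\Gamma\vdash\lambda a.M$; (v) from $\Gamma\vdash s\triangleright\Delta$, $\Delta\vdash M$ infer $\Gamma\vdash s\circ M$; (vi) $\Gamma\vdash id\triangleright\Gamma$; (vii) $\Gamma,a\vdash\pi_a\triangleright\Gamma$; (viii) from $\Gamma\vdash s\triangleright\Delta$, $\Gamma\vdash N$ infer $\Gamma\vdash\langle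 s\,,\,N\backslash a\rangle\triangleright\Delta,a$; (ix) from $\Gamma\vdash s\triangleright\Delta$, $\Delta\vdash q\triangleright\Sigma$ infer $\Gamma\vdash s\circ q\triangleright\Sigma$. The one-step reduction $\rightarrow$ on terms and substitutions is the compatible closure of: (Beta) $(\lambda a.M)N\rightarrow\langle id\,,\,N\backslash a\rangle\circ M$; (Abs) $s\circ\lambda a.M\rightarrow\lambda a.\langle\pi_a\circ s\,,\,a\backslash a\rangle\circ M$; (App) $s\circ MN\rightarrow(s\circ M)(s\circ N)$; (ConsVar) $\langle s\,,\,N\backslash a\rangle\circ a\rightarrow N$; (New) $\langle s\,,\,N\backslash a\rangle\circ b\rightarrow s\circ b$ ($a\neq b$); (IdVar) $id\circ a\rightarrow a$; (Clos) $s\circ q\circ M\rightarrow(s\circ q)\circ M$; (Ass) $s\circ q\circ r\rightarrow(s\circ q)\circ r$; (IdR) $s\circ id\rightarrow s$; (IdShift) $id\circ\pi_a\rightarrow\pi_a$; (ConsShift) $\langle s\,,\,N\backslash a\rangle\circ\pi_a\rightarrow s$; (Map) $s\circ\langle q\,,\,N\backslash a\rangle\rightarrow\langle s\circ q\,,\,s\circ N\backslash a\rangle$; ($\pi_1$) $\pi_a\circ b\rightarrow b$ ($a\neq b$); ($\pi_2$) $(s\circ\pi_a)\circ b\rightarrow s\circ b$ ($a\neq b$); ($\alpha_1$) $\lambda a.M\rightarrow\lambda b.\langle\pi_b\,,\,b\backslash a\rangle\circ M$ (under a side condition on free variables: $a$ free in $\lambda a.M$, $b$ not). *)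

(* Defs.v *)
From mathcomp Require Import all_boot.

Set Implicit Arguments.
Unset Strict Implicit.
Unset Printing Implicit Defensive.

Definition var := nat.

(* Raw named syntax: terms are not identified up to alpha-equivalence. *)
Inductive term : Type :=
| Var (a : var)
| App (M N : term)
| Lam (a : var) (M : term)
| Clos (s : subst) (M : term)            (* s ∘ M *)
with subst : Type :=
| Id
| Shift (a : var)                        (* π_a *)
| Ext (s : subst) (N : term) (a : var)  (* ⟨s , N\a⟩ *)
| Comp (s q : subst).                    (* s ∘ q *)

(* Contexts grow at the head: "Γ, a" is a :: Γ. *)
Definition ctx := seq var.

(* wf_term Γ M is Γ ⊢ M; wf_subst Γ s Δ is Γ ⊢ s ▹ Δ. *)
Inductive wf_term : ctx -> term -> Prop :=
| wf_var0 (G : ctx) (a : var) : wf_term (a :: G) (Var a)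
| wf_varS (G : ctx) (a b : var) :
    a <> b -> wf_term G (Var a) -> wf_term (b :: G) (Var a)
| wf_app (G : ctx) (M N : term) :
    wf_term G M -> wf_term G N -> wf_term G (App M N)
| wf_lam (G : ctx) (a : var) (M : term) :
    wf_term (a :: G) M -> wf_term G (Lam a M)
| wf_clos (G D : ctx) (s : subst) (M : term) :
    wf_subst G s D -> wf_term D M -> wf_term G (Clos s M)
with wf_subst : ctx -> subst -> ctx -> Prop :=
| wf_id (G : ctx) : wf_subst G Id G
| wf_shift (G : ctx) (a : var) : wf_subst (a :: G) (Shift a) G
| wf_ext (G D : ctx) (s : subst) (N : term) (a : var) :
    wf_subst G s D -> wf_term G N -> wf_subst G (Ext s N a) (a :: D)
| wf_comp (G D E : ctx) (s q : subst) :
    wf_subst G s D -> wf_subst D q E -> wf_subst G (Comp s q) E.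

(* Free variables.  Since contexts may repeat names, an occurrence refers to a
   name together with the number of more recent declarations of that name that
   it skips: Var a refers to (a, 0), and under π_a to (a, 1).  In particular a
   is free in λa.(π_a ∘ a). *)
Definition ref : Type := var * nat.

(* What a reference made under a declaration of a becomes outside of it;
   None if it points to that declaration. *)
Definition pop (a : var) (r : ref) : option ref :=
  if r.1 == a then (if r.2 is n.+1 then Some (a, n) else None) else Some r.

Definition push (a : var) (r : ref) : ref :=
  if r.1 == a then (a, r.2.+1) else r.

(* What a reference made under s becomes outside of s; None if s replaces it by
   a term, whose free variables are then already among those of s. *)
Fixpoint pass (s : subst) (r : ref) : option ref :=
  match s with
  | Id => Some r
  | Shift a => Some (push a r)
  | Ext s N a => obind (pass s) (pop a r)
  | Comp s q => obind (pass s) (pass q r)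
  end.

(* As usual for explicit substitutions, the free variables of N count in
   ⟨s , N\a⟩ ∘ M even if a does not occur in M:
   FV(⟨id , N\a⟩ ∘ M) = FV(N) ∪ (FV(M) \ a). *)
Fixpoint refs_term (M : term) : seq ref :=
  match M with
  | Var a => [:: (a, 0)]
  | App M N => refs_term M ++ refs_term N
  | Lam a M => pmap (pop a) (refs_term M)
  | Clos s M => refs_subst s ++ pmap (pass s) (refs_term M)
  end
with refs_subst (s : subst) : seq ref :=
  match s with
  | Id => [::]
  | Shift _ => [::]
  | Ext s N _ => refs_subst s ++ refs_term N
  | Comp s q => refs_subst s ++ pmap (pass s) (refs_subst q)
  end.

Definition FV (M : term) : seq var := map fst (refs_term M).

Inductive step_term : term -> term -> Prop :=
| Beta (a : var) (M N : term) :
    step_term (App (Lam a M) N) (Clos (Ext Id N a) M)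
| Abs (s : subst) (a : var) (M : term) :
    step_term (Clos s (Lam a M))
              (Lam a (Clos (Ext (Comp (Shift a) s) (Var a) a) M))
| AppR (s : subst) (M N : term) :
    step_term (Clos s (App M N)) (App (Clos s M) (Clos s N))
| ConsVar (s : subst) (N : term) (a : var) :
    step_term (Clos (Ext s N a) (Var a)) N
| New (s : subst) (N : term) (a b : var) :
    a <> b -> step_term (Clos (Ext s N a) (Var b)) (Clos s (Var b))
| IdVar (a : var) : step_term (Clos Id (Var a)) (Var a)
| ClosR (s q : subst) (M : term) :
    step_term (Clos s (Clos q M)) (Clos (Comp s q) M)
| Pi1 (a b : var) :
    a <> b -> step_term (Clos (Shift a) (Var b)) (Var b)
| Pi2 (s : subst) (a b : var) :
    a <> b -> step_term (Clos (Comp s (Shift a)) (Var b)) (Clos s (Var b))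
| Alpha1 (a b : var) (M : term) :
    a \in FV (Lam a M) -> b \notin FV (Lam a M) ->
    step_term (Lam a M) (Lam b (Clos (Ext (Shift b) (Var b) a) M))
| step_app_l (M M' N : term) :
    step_term M M' -> step_term (App M N) (App M' N)
| step_app_r (M N N' : term) :
    step_term N N' -> step_term (App M N) (App M N')
| step_lam (a : var) (M M' : term) :
    step_term M M' -> step_term (Lam a M) (Lam a M')
| step_clos_l (s s' : subst) (M : term) :
    step_subst s s' -> step_term (Clos s M) (Clos s' M)
| step_clos_r (s : subst) (M M' : term) :
    step_term M M' -> step_term (Clos s M) (Clos s M')
with step_subst : subst -> subst -> Prop :=
| Ass (s q r : subst) :
    step_subst (Comp s (Comp q r)) (Comp (Comp s q) r)
| IdR (s : subst) : step_subst (Comp s Id) s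
| IdShift (a : var) : step_subst (Comp Id (Shift a)) (Shift a)
| ConsShift (s : subst) (N : term) (a : var) :
    step_subst (Comp (Ext s N a) (Shift a)) s
| Map (s q : subst) (N : term) (a : var) :
    step_subst (Comp s (Ext q N a)) (Ext (Comp s q) (Clos s N) a)
| step_ext_l (s s' : subst) (N : term) (a : var) :
    step_subst s s' -> step_subst (Ext s N a) (Ext s' N a)
| step_ext_r (s : subst) (N N' : term) (a : var) :
    step_term N N' -> step_subst (Ext s N a) (Ext s N' a)
| step_comp_l (s s' q : subst) :
    step_subst s s' -> step_subst (Comp s q) (Comp s' q)
| step_comp_r (s q q' : subst) :
    step_subst q q' -> step_subst (Comp s q) (Comp s q').

(* Main.v *)
Require Import Defs.
From mathcomp Require Import all_boot.

(* Mutual induction on the two step relations. Except for variables, each syntactic form has a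
   single typing rule, so inverting the redex yields exactly the pieces that retype the contractum;
   compatible closure follows from the induction hypotheses. Variables only need moving past a
   declaration of another name. *)
Scheme step_term_mut := Minimality for step_term Sort Prop
  with step_subst_mut := Minimality for step_subst Sort Prop.

Combined Scheme step_mutind from step_term_mut, step_subst_mut.

(** Only [wf_varS] can end such a derivation. Needed for [New]; [Pi1] and [Pi2] use [wf_varS]
    itself, in the other direction. *)
Lemma wf_var_strengthen G a b : a <> b -> wf_term (a :: G) (Var b) -> wf_term G (Var b).
Proof. by move=> neq_ab wf_b; inversion wf_b; subst. Qed.

Lemma wf_clos_ext G D s N a M :
  wf_subst G s D -> wf_term G N -> wf_term (a :: D) M ->
  wf_term G (Clos (Ext s N a) M).
Proof. by move=> wf_s wf_N; apply/wf_clos/wf_ext. Qed.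

#[local] Hint Constructors wf_term wf_subst : wf.
#[local] Hint Resolve wf_var_strengthen wf_clos_ext not_eq_sym : wf.

Ltac wf_invert :=
  repeat match goal with
  | H : wf_term _ (App _ _) |- _ => inversion H; clear H; subst
  | H : wf_term _ (Lam _ _) |- _ => inversion H; clear H; subst
  | H : wf_term _ (Clos _ _) |- _ => inversion H; clear H; subst
  | H : wf_subst _ Id _ |- _ => inversion H; clear H; subst
  | H : wf_subst _ (Shift _) _ |- _ => inversion H; clear H; subst
  | H : wf_subst _ (Ext _ _ _) _ |- _ => inversion H; clear H; subst
  | H : wf_subst _ (Comp _ _) _ |- _ => inversion H; clear H; subst
  end.

(** Contexts are quantified after the step because [step_lam] and [step_clos_r] use the induction
    hypothesis in another context. *)
Lemma subject_reduction :
  (forall M1 M2, step_term M1 M2 -> forall G, wf_term G M1 -> wf_term G M2) /\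
  (forall s1 s2, step_subst s1 s2 ->
     forall G D, wf_subst G s1 D -> wf_subst G s2 D).
Proof. by apply: step_mutind; intros; wf_invert; eauto 8 with wf. Qed.

Theorem mainTheorem1 :
  (forall (G : ctx) (M1 M2 : term),
     wf_term G M1 -> step_term M1 M2 -> wf_term G M2) /\
  (forall (G D : ctx) (s1 s2 : subst),
     wf_subst G s1 D -> step_subst s1 s2 -> wf_subst G s2 D).
Proof.
have [sr_term sr_subst] := subject_reduction.
by split=> [G M1 M2 wf1 st | G D s1 s2 wf1 st]; eauto.
Qed.
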